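(* Let $S$ be a compact topological inverse semigroup. Then the following are equivalent: (i) $S$ is homeomorphic to a subspace of $\mathbb{N}^{\mathbb{N}}$ (and $I_{\mathbb{N}}$); (ii) $S$ embeds topologically into $I_{\mathbb{N}}$; (iii) $S$ embeds topologically into $\mathbb{N}^{\mathbb{N}}$; (iv) $S$ is metrizable and totally disconnected.
   Context: An inverse semigroup is a semigroup $S$ such that for each $x\in S$ there is a unique $x^{-1}\in S$ with $xx^{-1}x=x$ and $x^{-1}xx^{-1}=x^{-1}$. A topological inverse semigroup is an inverse semigroup with a topology for which both multiplication and inversion are continuous. A space is totally disconnected if its only connected subsets are singletons. $\mathbb{N}^{\mathbb{N}}$ is the monoid of all functions $\mathbb{N}\to\mathbb{N}$ under composition (functions act on the right and compose from left to right), with the product topology arising from the discrete topology on $\mathbb{N}$. $I_{\mathbb{N}}$ is the symmetric inverse monoid of all partial permutations of $\mathbb{N}$ (bijections between subsets of $\mathbb{N}$) under composition of binary relations, with the topology generated by the subbasis consisting of the sets $U_{x,y}=\{h : (x,y)\in h\}$, $W_x=\{h : x\notin\operatorname{dom}(h)\}$ and $W_x^{-1}=\{h : x\notin\operatorname{im}(h)\}$, for $x,y\in\mathbb{N}$. The spaces $\mathbb{N}^{\mathbb{N}}$ and $I_{\mathbb{N}}$ are homeomorphic (though not isomorphic as monoids), so in (i) being homeomorphic to a subspace of one is equivalent to being homeomorphic to a subspace of the other. An embedding of semigroups is an injective homomorphism; an embedding $\phi:S\to T$ of topological semigroups is topological if both $\phi$ and $\phi^{-1}:(S)\phi\to S$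 are continuous, where $(S)\phi$ has the subspace topology. ''$S$ embeds topologically into $T$'' means such a topological embedding exists. *)

(* Defs.v *)
From HB Require Import structures.
From mathcomp Require Import all_boot all_order all_algebra.
From mathcomp Require Import all_classical all_reals all_analysis.

Set Implicit Arguments.
Unset Strict Implicit.
Unset Printing Implicit Defensive.

Local Open Scope classical_set_scope.
Local Open Scope group_scope.

HB.structure Definition PreTopologicalSemigroup :=
  {S of Topological S & Semigroup S}.

HB.mixin Record Semigroup_isInverseSemigroup S of Semigroup S := {
  sinv : S -> S;
  sinvP : forall x : S, unique (fun y => x * y * x = x /\ y * x * y = y) (sinv x)
}.

#[short(type="inverseSemigroupType")]
HB.structure Definition InverseSemigroup :=
  {S of Semigroup_isInverseSemigroup S & Semigroup S}.

HB.structure Definition PreTopologicalInverseSemigroup :=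
  {S of Topological S & InverseSemigroup S}.

HB.mixin Record PreTopologicalInverseSemigroup_isTopological S
    of PreTopologicalInverseSemigroup S := {
  smul_continuous : continuous (fun xy : S * S => xy.1 * xy.2);
  sinv_continuous : continuous (sinv : S -> S)
}.

#[short(type="topologicalInverseSemigroupType")]
HB.structure Definition TopologicalInverseSemigroup :=
  {S of PreTopologicalInverseSemigroup_isTopological S
      & PreTopologicalInverseSemigroup S}.

Definition transf : Type := {ptws nat -> nat}.

HB.instance Definition _ := Topological.on transf.

(* Functions act on the right, so f * g is f followed by g. *)
Definition transf_mul (f g : transf) : transf := g \o f.

Definition transf_one : transf := idfun.

Fact transf_mulA : associative transf_mul. Proof. by []. Qed.
Fact transf_1mul : left_id transf_one transf_mul. Proof. by []. Qed.
Fact transf_mul1 : right_id transf_one transf_mul. Proof. by []. Qed.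

HB.instance Definition _ :=
  isMonoid.Build transf transf_mulA transf_1mul transf_mul1.

Record pperm := PPerm {
  pgraph : set (nat * nat);
  pperm_functional : forall x y z, pgraph (x, y) -> pgraph (x, z) -> y = z;
  pperm_injective : forall x y z, pgraph (x, z) -> pgraph (y, z) -> x = y
}.

HB.instance Definition _ := gen_eqMixin pperm.
HB.instance Definition _ := gen_choiceMixin pperm.

Lemma pperm_eq (f g : pperm) : pgraph f = pgraph g -> f = g.
Proof.
case: f g => [f f1 f2] [g g1 g2] /= fg; case: g / fg g1 g2 => g1 g2.
by congr PPerm; exact: Prop_irrelevance.
Qed.

Definition pperm_dom (h : pperm) : set nat := [set x | exists y, pgraph h (x, y)].
Definition pperm_im (h : pperm) : set nat := [set y | exists x, pgraph h (x, y)].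

Definition pperm_mul_graph (f g : pperm) : set (nat * nat) :=
  [set xz | exists2 y, pgraph f (xz.1, y) & pgraph g (y, xz.2)].

Fact pperm_mul_functional (f g : pperm) x y z :
  pperm_mul_graph f g (x, y) -> pperm_mul_graph f g (x, z) -> y = z.
Proof.
move=> [u /= fxu guy] [v /= fxv gvz].
move: guy; rewrite (pperm_functional fxu fxv) => gvy.
exact: (pperm_functional gvy gvz).
Qed.

Fact pperm_mul_injective (f g : pperm) x y z :
  pperm_mul_graph f g (x, z) -> pperm_mul_graph f g (y, z) -> x = y.
Proof.
move=> [u /= fxu guz] [v /= fyv gvz].
move: fxu; rewrite (pperm_injective guz gvz) => fxv.
exact: (pperm_injective fxv fyv).
Qed.

Definition pperm_mul (f g : pperm) : pperm :=
  PPerm (@pperm_mul_functional f g) (@pperm_mul_injective f g).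

Fact pperm_one_functional (x y z : nat) : x = y -> x = z -> y = z.
Proof. by move=> <-. Qed.

Fact pperm_one_injective (x y z : nat) : x = z -> y = z -> x = y.
Proof. by move=> -> ->. Qed.

Definition pperm_one : pperm :=
  @PPerm [set xy | xy.1 = xy.2] pperm_one_functional pperm_one_injective.

Fact pperm_mulA : associative pperm_mul.
Proof.
move=> f g h; apply: pperm_eq; apply/seteqP; split=> -[x y] /=.
- by move=> [u /= fxu [v /= guv hvy]]; exists v => //; exists u.
- by move=> [v /= [u /= fxu guv] hvy]; exists u => //; exists v.
Qed.

Fact pperm_1mul : left_id pperm_one pperm_mul.
Proof.
move=> f; apply: pperm_eq; apply/seteqP; split=> -[x y] /=.
- by move=> [u /= <-].
- by move=> fxy; exists x.
Qed.

Fact pperm_mul1 : right_id pperm_one pperm_mul.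
Proof.
move=> f; apply: pperm_eq; apply/seteqP; split=> -[x y] /=.
- by move=> [u /= + <-].
- by move=> fxy; exists y.
Qed.

HB.instance Definition _ :=
  isMonoid.Build pperm pperm_mulA pperm_1mul pperm_mul1.

Definition pperm_subbase : set (set pperm) :=
  [set A | (exists x y, A = [set h | pgraph h (x, y)])
        \/ (exists x, A = [set h | ~ pperm_dom h x])
        \/ (exists x, A = [set h | ~ pperm_im h x])].

HB.instance Definition _ := isSubBaseTopological.Build pperm pperm_subbase id.

Definition homeomorphic (X Y : topologicalType) : Prop :=
  exists (f : X -> Y) (g : Y -> X),
    [/\ continuous f, continuous g, cancel f g & cancel g f].

(* A set [A : set Y] used as a type carries the subspace topology of
   subtype_topology.v. *)
Definition homeomorphic_to_subspace (X Y : topologicalType) : Prop :=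
  exists A : set Y, homeomorphic X A.

Definition semigroup_embedding (S T : semigroupType) (phi : S -> T) : Prop :=
  injective phi /\ {morph phi : x y / x * y}.

(* As phi is injective, the condition on psi forces it to be the inverse of
   phi on the image of phi. *)
Definition topological_embedding (S T : PreTopologicalSemigroup.type)
    (phi : S -> T) : Prop :=
  [/\ semigroup_embedding phi, continuous phi
    & exists2 psi : range phi -> S,
        forall y, phi (psi y) = set_val y & continuous psi].

Definition embeds_topologically (S T : PreTopologicalSemigroup.type) : Prop :=
  exists phi : S -> T, topological_embedding phi.

Definition metrizable (R : realType) (X : topologicalType) : Prop :=
  exists M : metricType R, homeomorphic X M.

(* Main.v *)
Require Import Defs.
From HB Require Import structures.
From mathcomp Require Import all_boot all_order all_algebra.
From mathcomp Require Import all_classical all_reals all_analysis.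

(** All four conditions say, for a compact [S], that countably many clopen sets
    separate the points of [S] ([clopen_separated]).

    On the topological side, both [transf] and [pperm] have this property, and
    it is inherited by any space with a continuous injection into one of them.
    Conversely, given a separating sequence [C n], a point [x] can be recorded
    as the indicator function of the set of the [n] with [C n x], or as the
    identity on that set; these are continuous injections into [transf] and
    [pperm], and on a compact space such a map is a homeomorphism onto its
    range. Comparing the first index at which two points are separated gives an
    ultrametric for the topology. In the other direction, a compact metric space
    has only countably many clopen sets, and in a totally disconnected compact
    Hausdorff space clopen sets separate points, because the intersection of
    the clopen sets around a point is connected
    ([compact_totally_disconnected_zero_dimensional]).

    The algebraic content is the embedding into [pperm], a topological form of
    the Wagner-Preston theorem. [S] acts on the right on the countable set of
    its clopen subsets by D.s = {v | s v in D}. Any right action of an inverse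
    semigroup restricts to one by partial bijections: let [s] act only on the
    points fixed by s s^-1, where s^-1 undoes it ([wagner_preston_morph]).
    By compactness of [S] the map s |-> D.s is locally constant
    ([clopen_act_clopen]), which gives continuity; and since clopen sets separate
    points, [s] and [t] with the same action satisfy s v = s s^-1 t v for
    all v, and symmetrically, so that each lies below the other in the natural
    partial order ([clopen_wagner_preston_inj]).

    Finally, a partial permutation becomes a total function when a new point is
    added as the value where it is undefined. This homomorphism from [pperm] to
    [transf] is continuous and injective but its inverse is not continuous, as
    the topology of [transf] does not control the complement of the image;
    compactness of [S] makes its restriction to the image of [S] an embedding. *)

Set Implicit Arguments.
Unset Strict Implicit.
Unset Printing Implicit Defensive.

Import Order.TTheory GRing.Theory Num.Theory.

Local Open Scope classical_set_scope.

(** * Spaces whose points are separated by countably many clopen sets *)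

Definition clopen_separated (X : topologicalType) : Prop :=
  exists2 C : nat -> set X, forall n, clopen (C n)
    & forall x y, (forall n, C n x <-> C n y) -> x = y.

Lemma clopen_separated_countType (X : topologicalType) (I : countType)
    (C : I -> set X) :
  (forall i, clopen (C i)) ->
  (forall x y, (forall i, C i x <-> C i y) -> x = y) -> clopen_separated X.
Proof.
move=> Cclopen Csep.
exists (fun n => if unpickle n is Some i then C i else set0) => [n|x y xy].
  by case: (unpickle n) => [i|]; [exact: Cclopen|exact: clopen0].
by apply: Csep => i; have := xy (pickle i); rewrite pickleK.
Qed.

Lemma clopen_separated_inj (X Y : topologicalType) (f : X -> Y) :
  continuous f -> injective f -> clopen_separated Y -> clopen_separated X.
Proof.
move=> fc fi [C Cclopen Csep]; exists (fun n => f @^-1` C n) => [n|x y xy].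
  exact: preimage_clopen.
by apply: fi; exact: Csep.
Qed.

Lemma clopen_separated_zero_dimensional (X : topologicalType) :
  clopen_separated X -> zero_dimensional X.
Proof.
move=> [C Cclopen Csep] x y; apply: contra_neqP => /forallNP noU.
apply: Csep => n; split=> Cn; apply: contrapT => Cn'.
  exact: (noU (C n)).
by apply: (noU (~` C n)); split=> //; exact: (@clopenC _ _ set0).
Qed.

Lemma zero_dimensional_hausdorff (X : topologicalType) :
  zero_dimensional X -> hausdorff_space X.
Proof.
move=> zX; rewrite open_hausdorff => x y /zX[U [[oU cU] Ux Uy]].
exists (U, ~` U) => /=; first by rewrite !inE.
by split=> //; [exact: closed_openC|rewrite setICr].
Qed.

Lemma hausdorff_inj (X Y : topologicalType) (f : X -> Y) :
  continuous f -> injective f -> hausdorff_space Y -> hausdorff_space X.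
Proof.
move=> fc fi hY x y xy; apply: fi; apply: hY => A B Ax By.
by have [z [Az Bz]] := xy _ _ (fc _ _ Ax) (fc _ _ By); exists (f z).
Qed.

(** Closed sets of X are compact, hence so are their images, which are
    therefore closed. *)
Lemma compact_inverse_continuous (X Y : topologicalType) (f : X -> Y)
    (g : Y -> X) :
  compact [set: X] -> hausdorff_space Y -> continuous f ->
  cancel f g -> cancel g f -> continuous g.
Proof.
move=> cX hY fc fK gK; apply/continuousP => U oU.
rewrite -[_ @^-1` _]setCK; apply: closed_openC; apply: compact_closed => //.
have -> : ~` (g @^-1` U) = f @` (~` U).
  by apply/seteqP; split=> [y Uy|_ [x Ux <-]] /=; [exists (g y)|rewrite fK].
apply: continuous_compact; first exact: continuous_subspaceT.
by apply: (subclosed_compact _ cX) => //; exact: open_closedC.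
Qed.

Lemma continuous_to_range (X Y : topologicalType) (A : set Y) (f : X -> A) :
  continuous (set_val \o f) -> continuous f.
Proof.
move=> fc; apply/continuousP => _ [U oU <-].
by have /continuousP/(_ _ oU) := fc.
Qed.

Lemma clopen_separated_subspace (Y : topologicalType) (A : set Y) :
  clopen_separated Y -> clopen_separated A.
Proof.
apply: (@clopen_separated_inj A Y set_val); first exact: initial_continuous.
exact: val_inj.
Qed.

(** Produces both the homeomorphic copies and the topological embeddings:
    compactness makes the continuity of the inverse automatic. *)
Lemma compact_embedding (X Y : topologicalType) (f : X -> Y) :
  compact [set: X] -> clopen_separated Y -> continuous f -> injective f ->
  exists (f' : X -> range f) (g : range f -> X),
    [/\ continuous f', continuous g, cancel f' g, cancel g f' &
        forall x, set_val (f' x) = f x].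
Proof.
move=> cX sY fc fi.
have fr x : f x \in range f by rewrite inE; exists x.
pose f' x : range f := exist _ (f x) (fr x).
have ex (y : range f) : exists x, f x = set_val y.
  by case: y => y yr; have [x _ xy] := set_mem yr; exists x.
have [g gP] := choice ex.
have fK : cancel f' g by move=> x; apply: fi; rewrite gP.
have gK : cancel g f' by move=> y; apply: val_inj; rewrite /= gP.
have f'c : continuous f' by exact: continuous_to_range.
exists f', g; split=> //; apply: compact_inverse_continuous fK gK => //.
apply/zero_dimensional_hausdorff/clopen_separated_zero_dimensional.
exact: clopen_separated_subspace.
Qed.

Lemma compact_homeomorphic_to_subspace (X Y : topologicalType) (f : X -> Y) :
  compact [set: X] -> clopen_separated Y -> continuous f -> injective f ->
  homeomorphic_to_subspace X Y.
Proof.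
move=> cX sY fc fi; have [f' [g [f'c gc fK gK _]]] := compact_embedding cX sY fc fi.
by exists (range f), f', g.
Qed.

Lemma homeomorphic_to_subspace_clopen_separated (X Y : topologicalType) :
  homeomorphic_to_subspace X Y -> clopen_separated Y -> clopen_separated X.
Proof.
move=> [A [f [g [fc gc fK gK]]]] /(@clopen_separated_subspace Y A).
exact: clopen_separated_inj fc (can_inj fK).
Qed.

(** * Clopen sets in compact spaces *)

Definition quasicomponent (T : topologicalType) (x : T) : set T :=
  \bigcap_(D in [set D | clopen D /\ D x]) D.

(** Normality gives an open U around K1 whose closure misses K2, so the compact
    boundary of U misses the quasicomponent of x; the clopen sets around x
    being stable under finite intersection, one of them, D, already misses this
    boundary. Then D `&` U is clopen, and it separates x from K2. *)
Lemma quasicomponent_sub_closed (T : topologicalType) (x : T)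
    (K1 K2 : set T) :
  hausdorff_space T -> compact [set: T] ->
  closed K1 -> closed K2 -> K1 `&` K2 = set0 -> K1 x ->
  quasicomponent x `<=` K1 `|` K2 -> quasicomponent x `<=` K1.
Proof.
move=> hT cT cK1 cK2 K12 K1x QK.
have [U [oU K1U UK2]] : exists U,
    [/\ open U, K1 `<=` U & closure U `&` K2 = set0].
  have /(compact_normal hT cT cK1) : set_nbhs K1 (~` K2).
    apply/set_nbhsP; exists (~` K2); split=> //; first exact: closed_openC.
    exact/disjoints_subset.
  case=> V /set_nbhsP[U [oU K1U UV]] VK2; exists U; split=> //.
  by apply/disjoints_subset/(subset_trans _ VK2)/closureS.
pose F := filter_from [set D : set T | clopen D /\ D x] id.
have FF : Filter F.
  apply: filter_from_filter; first by exists setT; split => //; exact: clopenT.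
  by move=> A B [? ?] [? ?]; exists (A `&` B) => //; split=> //; exact: clopenI.
have PF : ProperFilter F by apply: filter_from_proper; move=> ? [_ ?]; exists x.
have [D [[clD Dx] DU]] : exists D, [/\ clopen D /\ D x & D `&` closure U `<=` U].
  have /(iffLR (compact_near_coveringP _)) : compact (closure U `\` U).
    apply: (subclosed_compact _ cT) => //.
    by apply: closedI; [exact: closed_closure|exact: open_closedC].
  move=> /(_ _ _ setC (powerset_filter_from_filter PF))[].
    move=> y [Uy nUy].
    have [D [[oD cD] Dx] nDy] : exists2 D, clopen D /\ D x & ~ D y.
      apply: contrapT => /forall2NP noD.
      suff /QK[/K1U//|K2y] : quasicomponent x y.
        by have : (closure U `&` K2) y by []; rewrite UK2.
      by move=> D [clD Dx]; have [nD|/contrapT//] := noD D; case: nD.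
    exists (~` D, [set E | E `<=` D]); first split.
    - by apply: open_nbhs_nbhs; split=> //; exact: closed_openC.
    - apply/near_powerset_filter_fromP; first by move=> ? ?; exact: subset_trans.
      by exists D => //; exists D.
    - by case=> i j [? /subsetC]; apply.
  move=> N [NF _ [E NE]] /(_ _ NE) EU; have [D DP DE] := NF _ NE.
  exists D; split=> // z [Dz Uz]; apply: contrapT => nUz.
  by apply: EU (DE _ Dz).
move=> y Qy; have /(Qy _)[_ Uy] : clopen (D `&` U) /\ (D `&` U) x.
  split; last by split=> //; exact: K1U.
  case: clD => oD cD; split; first exact: openI.
  suff -> : D `&` U = D `&` closure U by apply: closedI => //; exact: closed_closure.
  apply/seteqP; split=> z [Dz Uz]; first by split=> //; exact: subset_closure.
  by split=> //; exact: DU.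
case: (QK y Qy) => // K2y.
have : (closure U `&` K2) y by split=> //; exact: subset_closure.
by rewrite UK2.
Qed.

(** Quasicomponents are connected here: in a splitting into two disjoint closed
    parts, the part which contains x is everything by the previous lemma. So
    they lie in components, which are singletons. *)
Lemma compact_totally_disconnected_zero_dimensional (T : topologicalType) :
  hausdorff_space T -> compact [set: T] -> totally_disconnected [set: T] ->
  zero_dimensional T.
Proof.
move=> hT cT tdT x y; apply: contra_neqP => /forallNP noU.
pose Q := quasicomponent x.
have cQ : closed Q by rewrite /Q /quasicomponent; apply: closed_bigI => D [[]].
have Qx : Q x by move=> D [].
suff Qconn : connected Q.
  have /(_ y) := @connected_component_max _ setT Q x Qx (@subsetT _ _) Qconn.
  rewrite tdT//= => -> // D [clD Dx].
  by apply: contrapT => Dy; apply: (noU D).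
move=> B [z Bz] [C oC BC] [C' cC' BC'].
have clB : closed B by rewrite BC'; exact: closedI.
have clB' : closed (Q `\` C) by apply: closedI => //; exact: open_closedC.
have Qcov : Q `<=` B `|` (Q `\` C).
  move=> u Qu; have [Cu|nCu] := pselect (C u); first by left; rewrite BC.
  by right.
have disj : B `&` (Q `\` C) = set0.
  by rewrite BC; apply/seteqP; split=> u // [[_ Cu] [_ /(_ Cu)]].
have BQ : B `<=` Q by rewrite BC => u [].
apply/seteqP; split=> //.
case: (Qcov x Qx) => [Bx|B'x].
  exact: (quasicomponent_sub_closed hT cT clB clB' disj Bx Qcov).
have disj' : (Q `\` C) `&` B = set0 by rewrite setIC.
have Qcov' : Q `<=` (Q `\` C) `|` B by rewrite setUC.
have [_ []] := quasicomponent_sub_closed hT cT clB' clB disj' B'x Qcov' (BQ _ Bz).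
by move: Bz; rewrite BC => -[].
Qed.

(** A compact metric space is second countable, and each of its clopen sets is a
    finite union of members of a countable basis. *)
Lemma compact_metric_clopen_countable (R : realType) (M : metricType R) :
  compact [set: M] -> countable (@clopen M).
Proof.
move=> cM; have [[x0 _]|/forallNP M0] := pselect (exists x : M, True).
  pose pM : pseudoPMetricType R := HB.pack (M : Type) (PseudoMetric.on M)
    (isPointed.Build (M : Type) x0).
  exact: (@clopen_countable pM cM (@compact_second_countable R pM cM)).
(* The empty space has no base point. *)
apply: (@sub_countable _ _ _ [set set0]); last exact: countable1.
apply: subset_card_le => A _ /=; apply/seteqP; split=> // x.
by case: (M0 x).
Qed.

Lemma homeomorphic_clopen_countable (X Y : topologicalType) :
  homeomorphic X Y -> countable (@clopen Y) -> countable (@clopen X).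
Proof.
move=> [f [g [fc gc fK gK]]] /countable_injP[e einj]; apply/countable_injP.
exists (fun D => e (g @^-1` D)) => D E /set_mem clD /set_mem clE /einj eqDE.
have {}eqDE : g @^-1` D = g @^-1` E.
  by apply: eqDE; apply/mem_set; exact: preimage_clopen.
apply/funext => x; rewrite -(fK x).
exact: (congr1 (fun A : set Y => A (f x)) eqDE).
Qed.

Lemma homeomorphic_compact (X Y : topologicalType) :
  homeomorphic X Y -> compact [set: X] -> compact [set: Y].
Proof.
move=> [f [g [fc gc fK gK]]] cX.
have <- : f @` [set: X] = [set: Y].
  by apply/seteqP; split=> // y _; exists (g y).
by apply: continuous_compact => //; exact: continuous_subspaceT.
Qed.

Lemma compact_metrizable_clopen_countable (R : realType) (X : topologicalType) :
  compact [set: X] -> metrizable R X -> countable (@clopen X).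
Proof.
move=> cX [M XM]; apply: homeomorphic_clopen_countable (XM) _.
exact/compact_metric_clopen_countable/(homeomorphic_compact XM).
Qed.

(** Clopen sets are indexed by their codes, the indices which code none being
    sent to the empty set. *)
Lemma countable_clopen_separated (X : topologicalType) :
  countable (@clopen X) -> zero_dimensional X -> clopen_separated X.
Proof.
move=> /countable_injP[e einj] zX.
exists (fun n => [set x | exists D, [/\ clopen D, e D = n & D x]]) => [n|x y xy].
  have [[D [clD eD]]|noD] := pselect (exists D, clopen D /\ e D = n).
    suff -> : [set x | exists D, [/\ clopen D, e D = n & D x]] = D by [].
    apply/seteqP; split=> [x [E [clE eE Ex]]|x Dx]; last by exists D.
    by rewrite (einj D E) ?eD//; exact/mem_set.
  suff -> : [set x | exists D, [/\ clopen D, e D = n & D x]] = set0.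
    exact: clopen0.
  by apply/seteqP; split=> // x [D [? ? _]]; apply: noD; exists D.
apply: contrapT => /eqP/zX[U [clU Ux Uy]].
have [|D [clD /einj DU Dy]] := iffLR (xy (e U)); first by exists U.
by apply: Uy; rewrite -DU//; exact/mem_set.
Qed.

(** * The ultrametric of a separating sequence of clopen sets *)

Section separation_metric.
Context (R : realType) (X : choiceType) (C : nat -> set X).
Hypothesis Csep : forall x y, (forall n, C n x <-> C n y) -> x = y.

Local Open Scope ring_scope.

Let differ x y n := ~~ `[< C n x <-> C n y >].

Definition separation_dist (x y : X) : R :=
  if pselect (exists n, differ x y n) is left h then (ex_minn h).+1%:R^-1 else 0.

(** Small balls are the classes of agreement up to a given index, which yields
    symmetry, the triangle inequality and the comparison of topologies. *)
Lemma separation_dist_lt n x y :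
  (separation_dist x y < n.+1%:R^-1) <->
  (forall k, (k <= n)%N -> C k x <-> C k y).
Proof.
rewrite /separation_dist; case: pselect => [h|nodiff]; last first.
  split=> [_ k _|_]; last by rewrite invr_gt0.
  by apply/asboolP; apply: contrapT => /negP dk; apply: nodiff; exists k.
case: ex_minnP => m dm mmin; rewrite ltf_pV2 ?posrE// ltr_nat ltnS; split.
  move=> nm k kn; apply/asboolP/negPn/negP => /mmin mk.
  by have := leq_trans nm (leq_trans mk kn); rewrite ltnn.
move=> agree; rewrite ltnNge; apply/negP => mn.
by move: dm; rewrite /differ; case: asboolP => // nd; case: nd; exact: agree.
Qed.

Lemma separation_dist_ge0 x y : 0 <= separation_dist x y.
Proof. by rewrite /separation_dist; case: pselect. Qed.

Lemma separation_distxx x : separation_dist x x = 0.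
Proof.
rewrite /separation_dist; case: pselect => // h; exfalso; case: h => n.
by rewrite /differ asboolT.
Qed.

Lemma separation_dist_eq0 x y : separation_dist x y = 0 -> x = y.
Proof.
move=> d0; apply: Csep => n.
by apply: (iffLR (separation_dist_lt n x y)) => //; rewrite d0 invr_gt0.
Qed.

Lemma separation_dist_sym x y : separation_dist x y = separation_dist y x.
Proof.
suff le u v : separation_dist u v <= separation_dist v u.
  by apply/eqP; rewrite eq_le !le.
rewrite leNgt; apply/negP; rewrite {2}/separation_dist.
case: pselect => [h|_]; last by rewrite ltNge separation_dist_ge0.
move=> /separation_dist_lt uv.
have : separation_dist u v < (ex_minn h).+1%:R^-1.
  by apply/separation_dist_lt => k /uv[].
rewrite /separation_dist; case: pselect => // h'.
by rewrite (Prop_irrelevance h' h) ltxx.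
Qed.

Lemma separation_dist_triangle y x z :
  separation_dist x z <= separation_dist x y + separation_dist y z.
Proof.
rewrite {1}/separation_dist; case: pselect => [h|_]; last first.
  by rewrite addr_ge0 ?separation_dist_ge0.
case: ex_minnP => m dm _; rewrite leNgt; apply/negP => lt.
have /separation_dist_lt xy : separation_dist x y < m.+1%:R^-1.
  by apply: le_lt_trans lt; rewrite lerDl separation_dist_ge0.
have /separation_dist_lt yz : separation_dist y z < m.+1%:R^-1.
  by apply: le_lt_trans lt; rewrite lerDr separation_dist_ge0.
by move/negP: dm; apply; apply/asboolP; rewrite xy// yz.
Qed.

End separation_metric.

(** Each ball is a finite intersection of the sets C k and their complements, so
    the metric topology is coarser than that of X, and equal to it by
    compactness. *)
Lemma compact_clopen_separated_metrizable (R : realType) (X : topologicalType) :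
  compact [set: X] -> clopen_separated X -> metrizable R X.
Proof.
move=> cX [C Cclopen Csep].
pose M : metricType R := HB.pack (X : Type)
  (Choice.on X) (isMetric.Build R (X : Type) (@separation_distxx R X C)
    (separation_dist_eq0 Csep) (@separation_dist_sym R X C)
    (@separation_dist_triangle R X C)).
have idc : continuous (id : X -> M).
  move=> x; apply/metricType_numDomainType.cvgrPdist_lt => e e0.
  have [n ne] : exists n, (n.+1%:R^-1 < e :> R)%R.
    have [//|n] := @ltr_add_invr R 0%R e; rewrite add0r => ?; by exists n.
  suff : \forall y \near x, forall k, (k < n.+1)%N -> C k x <-> C k y.
    apply: filterS => y xy; apply: lt_trans ne; apply/separation_dist_lt => k.
    exact: xy.
  elim: n.+1 => [|m IH]; first exact: filterE.
  have Cm : \forall y \near x, C m x <-> C m y.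
    have [oC cC] := Cclopen m.
    have [Cx|nCx] := pselect (C m x).
      by apply: filterS (open_nbhs_nbhs (conj oC Cx)) => y.
    by apply: filterS (open_nbhs_nbhs (conj (closed_openC cC) nCx)) => y.
  apply: filterS2 IH Cm => y IH Cm k; rewrite ltnS leq_eqVlt => /predU1P[->//|].
  exact: IH.
exists M, id, id; split=> //.
by apply: (@compact_inverse_continuous _ _ (id : X -> M)) => //; exact: metric_hausdorff.
Qed.

(** * The spaces of transformations and of partial permutations *)

Lemma transf_eval_clopen x y : clopen [set f : transf | f x = y].
Proof.
have evalc : continuous (fun f : transf => f x).
  exact: (@proj_continuous nat (fun=> nat) x).
apply: (@preimage_clopen _ _ _ [set y]) => //.
by split; [exact: discrete_open|exact: discrete_closed].
Qed.

Lemma continuous_transf (X : topologicalType) (F : X -> transf) :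
  (forall n m, open [set x | F x n = m]) -> continuous F.
Proof.
move=> Fo x; apply/pointwise_cvgP => n.
apply/discrete_cvg; have := Fo n (F x n); rewrite openE => /(_ x erefl).
exact.
Qed.

Lemma clopen_separated_transf : clopen_separated transf.
Proof.
apply: (@clopen_separated_countType transf (nat * nat)%type
  (fun xy => [set f : transf | f xy.1 = xy.2])) => [[x y]|f g fg].
  exact: transf_eval_clopen.
by apply/funext => x; apply/esym/(iffLR (fg (x, f x))).
Qed.

Lemma pperm_subbase_open (A : set pperm) : pperm_subbase A -> open A.
Proof.
move=> sA; exists [set A]; last by rewrite bigcup_set1.
by move=> _ ->; exact: (@finI_from1 _ _ _ id).
Qed.

Lemma continuous_pperm (X : topologicalType) (F : X -> pperm) :
  (forall A, pperm_subbase A -> open (F @^-1` A)) -> continuous F.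
Proof.
move=> Fo; apply/continuousP => _ [D sD <-].
rewrite preimage_bigcup; apply: bigcup_open => A /sD [E sE <-].
rewrite preimage_bigcap openE => x Ex; apply: filter_bigI => U UE.
have /= Ux := Ex _ UE; have /set_mem sU := sE _ UE.
by apply: open_nbhs_nbhs; split=> //; exact: Fo.
Qed.

(** A partial permutation avoids (x, y) exactly when it is undefined at x or maps
    x elsewhere, both of which are open conditions. *)
Lemma pperm_graph_clopen x y : clopen [set h | pgraph h (x, y)].
Proof.
split; first by apply: pperm_subbase_open; left; exists x, y.
rewrite -[X in closed X]setCK; apply: open_closedC.
have -> : ~` [set h | pgraph h (x, y)] = [set h | ~ pperm_dom h x] `|`
    \bigcup_(z in [set z | z <> y]) [set h | pgraph h (x, z)].
  apply/seteqP; split=> [h hxy|h [hx hxy|[z zy hxz hxy]]] /=.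
  - have [[z hxz]|] := pselect (pperm_dom h x); last by left.
    by right; exists z => // zy; apply: hxy; rewrite -zy.
  - by apply: hx; exists y.
  - exact/zy/(pperm_functional hxz hxy).
apply: openU; first by apply: pperm_subbase_open; right; left; exists x.
by apply: bigcup_open => z _; apply: pperm_subbase_open; left; exists x, z.
Qed.

Lemma clopen_separated_pperm : clopen_separated pperm.
Proof.
apply: (@clopen_separated_countType pperm (nat * nat)%type
  (fun xy => [set h : pperm | pgraph h xy])) => [[x y]|f g fg].
  exact: pperm_graph_clopen.
by apply/pperm_eq/seteqP; split=> xy /fg.
Qed.

Lemma clopen_separated_inj_transf (X : topologicalType) :
  clopen_separated X -> exists2 f : X -> transf, continuous f & injective f.
Proof.
move=> [C Cclopen Csep].
exists (fun x n => `[< C n x >] : nat).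
  apply: continuous_transf => n m.
  have [oC cC] := Cclopen n.
  case: m => [|[|m]].
  - rewrite (_ : mkset _ = ~` C n); first exact: closed_openC.
    by apply/seteqP; split=> x /=; case: asboolP.
  - rewrite (_ : mkset _ = C n)//.
    by apply/seteqP; split=> x /=; case: asboolP.
  - rewrite (_ : mkset _ = set0); first exact: open0.
    by apply/seteqP; split=> x //=; case: asboolP.
move=> x y /= xy; apply: Csep => n.
by have /(congr1 (fun f => f n)) := xy; do 2!case: asboolP.
Qed.

Program Definition pperm_id (A : set nat) : pperm :=
  @PPerm [set xy | A xy.1 /\ xy.1 = xy.2] _ _.
Next Obligation. by move=> A x y z /= [_ <-] [_ <-]. Qed.
Next Obligation. by move=> A x y z /= [_ ->] [_ ->]. Qed.

Lemma clopen_separated_inj_pperm (X : topologicalType) :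
  clopen_separated X -> exists2 f : X -> pperm, continuous f & injective f.
Proof.
move=> [C Cclopen Csep]; exists (fun x => pperm_id [set n | C n x]).
  apply: continuous_pperm => A [[n [m ->]]|[[n ->]|[n ->]]].
  - have [nm|nm] := pselect (n = m).
      by rewrite (_ : _ @^-1` _ = C n); [case: (Cclopen n)|apply/seteqP; split=> x /=; tauto].
    by rewrite (_ : _ @^-1` _ = set0); [exact: open0|apply/seteqP; split=> x /= []].
  - rewrite (_ : _ @^-1` _ = ~` C n); first exact: closed_openC (Cclopen n).2.
    apply/seteqP; split=> x /= nC Cn; apply: nC; first by exists n.
    by case: Cn => m [].
  - rewrite (_ : _ @^-1` _ = ~` C n); first exact: closed_openC (Cclopen n).2.
    apply/seteqP; split=> x /= nC Cn; apply: nC; first by exists n.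
    by case: Cn => m [/=] + mn; rewrite -mn.
move=> x y /(congr1 (fun h => pgraph h)) xy; apply: Csep => n.
split=> Cn.
  have : [set xy : nat * nat | C xy.1 x /\ xy.1 = xy.2] (n, n) by [].
  by rewrite [mkset _]xy => -[].
have : [set xy : nat * nat | C xy.1 y /\ xy.1 = xy.2] (n, n) by [].
by rewrite -[mkset _]xy => -[].
Qed.

(** * Inverse semigroups *)

Local Open Scope group_scope.

Section inverse_semigroup.
Context (S : inverseSemigroupType).
Implicit Types x y s t e f : S.

Lemma mulgVg x : x * sinv x * x = x.
Proof. by case: (sinvP x) => -[]. Qed.

Lemma mulVgV x : sinv x * x * sinv x = sinv x.
Proof. by case: (sinvP x) => -[]. Qed.

Lemma sinv_uniq x y : x * y * x = x -> y * x * y = y -> sinv x = y.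
Proof. by move=> xyx yxy; case: (sinvP x) => _; apply. Qed.

Lemma sinvK x : sinv (sinv x) = x.
Proof. by apply: sinv_uniq; rewrite ?mulgVg ?mulVgV. Qed.

Lemma idem_sinv e : e * e = e -> sinv e = e.
Proof. by move=> ee; apply: sinv_uniq; rewrite !ee. Qed.

Lemma idem_mulgV x : x * sinv x * (x * sinv x) = x * sinv x.
Proof. by rewrite mulgA mulgVg. Qed.

Lemma idem_mulVg x : sinv x * x * (sinv x * x) = sinv x * x.
Proof. by rewrite mulgA mulVgV. Qed.

Lemma idem_mulKg e x : e * e = e -> e * (e * x) = e * x.
Proof. by move=> ee; rewrite mulgA ee. Qed.

(** The inverse a of e f satisfies a = f a e by uniqueness, whence a a = a. An
    idempotent is its own inverse, so e f = a. *)
Lemma idem_mul e f : e * e = e -> f * f = f -> e * f * (e * f) = e * f.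
Proof.
move=> ee ff; have eeK x := idem_mulKg x ee; have ffK x := idem_mulKg x ff.
set a := sinv (e * f).
have efa : e * f * a * (e * f) = e * f by exact: mulgVg.
have aef : a * (e * f) * a = a by exact: mulVgV.
have aE : a = f * a * e.
  apply: sinv_uniq.
    by rewrite -[RHS]efa -!mulgA ffK eeK.
  by rewrite -[X in _ = f * X * e]aef -!mulgA eeK ffK.
have aa : a * a = a.
  by rewrite {1}aE [X in _ * X]aE -!mulgA mulgA [RHS]aE -[X in _ = f * X * e]aef -!mulgA.
by rewrite -(sinvK (e * f)) -/a (idem_sinv aa) aa.
Qed.

(** Both e f and f e are inverses of the idempotent e f. *)
Lemma idemC e f : e * e = e -> f * f = f -> e * f = f * e.
Proof.
move=> ee ff; have ef := idem_mul ee ff; have fe := idem_mul ff ee.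
rewrite -(idem_sinv ef); apply: sinv_uniq.
  by rewrite -[RHS]ef -!mulgA (idem_mulKg _ ff) (idem_mulKg _ ee).
by rewrite -[RHS]fe -!mulgA (idem_mulKg _ ee) (idem_mulKg _ ff).
Qed.

Lemma mulVg_mulgVC s t : sinv s * s * (t * sinv t) = t * sinv t * (sinv s * s).
Proof. exact: idemC (idem_mulVg s) (idem_mulgV t). Qed.

Lemma sinvM s t : sinv (s * t) = sinv t * sinv s.
Proof.
have C1 x : t * (sinv t * (sinv s * (s * x))) = sinv s * (s * (t * (sinv t * x))).
  by rewrite !mulgA -(mulgA _ (sinv s)) -mulVg_mulgVC !mulgA.
have C2 x : sinv s * (s * (t * (sinv t * x))) = t * (sinv t * (sinv s * (s * x))).
  by rewrite C1.
apply: sinv_uniq; rewrite -!mulgA.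
  by rewrite C1 !mulgA mulgVg -!mulgA (mulgA t) mulgVg.
by rewrite C2 !mulgA mulVgV -!mulgA (mulgA (sinv s)) mulVgV.
Qed.

(** Antisymmetry of the natural partial order, in which s lies below t when
    s = t e for an idempotent e. *)
Lemma natural_order_anti s t e f : e * e = e -> f * f = f ->
  s = t * e -> t = s * f -> s = t.
Proof.
move=> ee ff st ts; have tef : t * (e * f) = t by rewrite mulgA -st -ts.
by rewrite st -{1}tef -!mulgA -(idemC ee ff) (idem_mulKg _ ee).
Qed.

Lemma idem_conj s e : e * e = e ->
  sinv s * e * s * (sinv s * e * s) = sinv s * e * s.
Proof.
move=> ee; rewrite -!mulgA (mulgA s (sinv s)) (mulgA e (s * sinv s)).
by rewrite (idemC ee (idem_mulgV s)) -!mulgA (idem_mulKg _ ee) !mulgA mulVgV.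
Qed.

(** Idempotents can be moved across s, so multiples e s are also below s on the
    other side. *)
Lemma idem_mul_swap s e : e * e = e -> e * s = s * (sinv s * e * s).
Proof.
by move=> ee; rewrite !mulgA (idemC (idem_mulgV s) ee) -mulgA mulgVg.
Qed.

End inverse_semigroup.

(** * Partial bijections from a right action *)

Section wagner_preston.
Context (S : inverseSemigroupType) (X : Type).
Variables (code : X -> nat) (act : X -> S -> X).
Hypothesis code_inj : injective code.
Hypothesis actM : forall x s t, act x (s * t) = act (act x s) t.

(** On the points fixed by s s^-1 the action of s is undone by that of s^-1, so
    that restricting it to them makes it injective. *)
Definition action_graph (s : S) : set (nat * nat) :=
  [set ab | exists x, [/\ act x (s * sinv s) = x,
                          code x = ab.1 & code (act x s) = ab.2]].

Lemma action_graph_functional s a b c :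
  action_graph s (a, b) -> action_graph s (a, c) -> b = c.
Proof. by move=> [x [_ /= <- <-]] [y [_ /= /code_inj -> <-]]. Qed.

Lemma action_graph_injective s a b c :
  action_graph s (a, c) -> action_graph s (b, c) -> a = b.
Proof.
move=> [x [dx /= <- <-]] [y [dy /= <- /code_inj yx]].
by rewrite -dx -dy !actM yx.
Qed.

Definition wagner_preston (s : S) : pperm :=
  PPerm (@action_graph_functional s) (@action_graph_injective s).

(** The domains compose as those of partial functions do; this is where the
    commutation of the idempotents s^-1 s and t t^-1 is used. *)
Lemma act_dom_mul x s t :
  act x (s * t * sinv (s * t)) = x <->
  act x (s * sinv s) = x /\ act (act x s) (t * sinv t) = act x s.
Proof.
rewrite sinvM; split=> [dx|[dx dt]]; last first.
  by rewrite !mulgA actM -(mulgA s) actM dt -actM.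
split.
  rewrite -[in LHS]dx -actM -[RHS]dx; congr (act x _).
  by rewrite -!mulgA (mulgA (sinv s)) mulVgV.
rewrite -[in RHS]dx -!actM; congr (act x _).
have -> : s * t * (sinv t * sinv s) * s = s * (t * sinv t * (sinv s * s)).
  by rewrite !mulgA.
by rewrite -mulVg_mulgVC !mulgA mulgVg.
Qed.

Lemma wagner_preston_morph : {morph wagner_preston : s t / s * t}.
Proof.
move=> s t; apply/pperm_eq/seteqP; split=> -[a b].
  move=> [x [/act_dom_mul[ds dt] /= <- <-]].
  exists (code (act x s)); first by exists x.
  by exists (act x s); split=> //=; rewrite actM.
move=> [c [x [dx /= <- <-]] [y [dy /= /code_inj yx <-]]]; subst y.
by exists x; split=> //=; [apply/act_dom_mul|rewrite actM].
Qed.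

Lemma wagner_preston_sinv s a b :
  action_graph (sinv s) (a, b) <-> action_graph s (b, a).
Proof.
have inv r c d : action_graph r (c, d) -> action_graph (sinv r) (d, c).
  move=> [x [dx /= <- <-]]; exists (act x r).
  by split=> //=; rewrite -actM ?sinvK ?mulgA ?mulgVg// dx.
by split=> /inv //; rewrite sinvK.
Qed.

(** The point y = x s^-1 is in the domain of s, so partial maps which agree must
    send it to the same point. *)
Lemma wagner_preston_eq s t x : wagner_preston s = wagner_preston t ->
  act x (sinv s * s) = act x (sinv s * t).
Proof.
move=> /(congr1 pgraph) /= st; rewrite !actM; set y := act x (sinv s).
have : action_graph s (code y, code (act y s)).
  by exists y; rewrite -actM mulgA mulVgV.
by rewrite st => -[z [_ /= /code_inj <- /code_inj]].
Qed.

End wagner_preston.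

(** When the orbit maps are locally constant, so are the conditions of belonging
    to the domain. Undefinedness on the image side reduces to the domain side by
    inversion, which is continuous. *)
Lemma wagner_preston_continuous (S : topologicalInverseSemigroupType)
    (X : Type) (code : X -> nat) (act : X -> S -> X) (code_inj : injective code)
    (actM : forall x s t, act x (s * t) = act (act x s) t) :
  (forall x y, clopen [set s | act x s = y]) ->
  continuous (wagner_preston code_inj actM).
Proof.
move=> act_clopen.
have idem_clopen x : clopen [set s : S | act x (s * sinv s) = x].
  suff mulVc : continuous (fun s : S => s * sinv s).
    exact: preimage_clopen (act_clopen x x) mulVc.
  move=> s; apply: (@continuous_comp S (S * S)%type S (fun s : S => (s, sinv s))
    (fun xy => xy.1 * xy.2)); last exact: smul_continuous.
  by apply: cvg_pair => //; exact: sinv_continuous.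
have Wdom a : open [set s | ~ pperm_dom (wagner_preston code_inj actM s) a].
  have [[x xa]|noa] := pselect (exists x, code x = a).
    have -> : [set s | ~ pperm_dom (wagner_preston code_inj actM s) a] =
        ~` [set s : S | act x (s * sinv s) = x].
      apply/seteqP; split=> s /= nd d; apply: nd.
        by exists (code (act x s)); exists x.
      by move: d => [b [y [dy /= yb _]]]; rewrite -(code_inj y x)// yb.
    exact: closed_openC (idem_clopen x).2.
  rewrite (_ : mkset _ = setT); first exact: openT.
  by apply/seteqP; split=> // s _ [b [x [_ xa _]]]; apply: noa; exists x.
apply: continuous_pperm => A [[a [b ->]]|[[a ->]|[b ->]]].
- have -> : wagner_preston code_inj actM @^-1` [set h | pgraph h (a, b)] =
      \bigcup_(xy in [set xy | code xy.1 = a /\ code xy.2 = b])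
        ([set s | act xy.1 (s * sinv s) = xy.1] `&` [set s | act xy.1 s = xy.2]).
    apply/seteqP; split=> s /=.
      by move=> [x [dx xa xb]]; exists (x, act x s).
    by move=> [[x y] [/= xa yb] [dx xy]]; exists x; rewrite xy.
  apply: bigcup_open => xy _.
  by apply: openI; [exact: (idem_clopen _).1|exact: (act_clopen _ _).1].
- exact: Wdom.
- have -> : wagner_preston code_inj actM @^-1` [set h | ~ pperm_im h b] =
      sinv @^-1` [set s | ~ pperm_dom (wagner_preston code_inj actM s) b].
    apply/seteqP; split=> s /= ns [a sab]; apply: ns; exists a.
      exact: (iffLR (wagner_preston_sinv code actM _ _ _) sab).
    exact: (iffRL (wagner_preston_sinv code actM _ _ _) sab).
  exact: (iffLR (continuousP sinv) (@sinv_continuous S)).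
Qed.

Section clopen_action.
Context (S : topologicalInverseSemigroupType).

Lemma continuous_mulg (s : S) : continuous (fun v : S => s * v).
Proof.
move=> v; apply: (@continuous_comp S (S * S)%type S (fun v : S => (s, v))
    (fun xy => xy.1 * xy.2)); last exact: smul_continuous.
by apply: cvg_pair => //; exact: cvg_cst.
Qed.

Lemma continuous_mulgr (v : S) : continuous (fun s : S => s * v).
Proof.
move=> s; apply: (@continuous_comp S (S * S)%type S (fun s : S => (s, v))
    (fun xy => xy.1 * xy.2)); last exact: smul_continuous.
by apply: cvg_pair => //; exact: cvg_cst.
Qed.

Definition clopen_type := {D : set S | clopen D}.

(** Taking preimages turns left multiplications into a right action on sets. *)
Definition clopen_act (D : clopen_type) (s : S) : clopen_type :=
  exist _ ((fun v => s * v) @^-1` sval D)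
    (preimage_clopen (svalP D) (@continuous_mulg s)).

Lemma clopen_type_inj : injective (sval : clopen_type -> set S).
Proof. by move=> D E; exact: eq_sig_hprop. Qed.

Lemma clopen_actM D s t :
  clopen_act D (s * t) = clopen_act (clopen_act D s) t.
Proof. by apply: clopen_type_inj; apply/seteqP; split=> v /=; rewrite mulgA. Qed.

(** D.s = E is a condition on all v; each instance of it is clopen in s, which
    gives closedness, and the tube lemma over the compact S gives openness. *)
Lemma clopen_act_clopen (S_compact : compact [set: S]) (D E : clopen_type) :
  clopen [set s | clopen_act D s = E].
Proof.
case: D E => [D clD] [E clE]; have [[oD cD] [oE cE]] := (clD, clE).
have -> : [set s | clopen_act (exist _ D clD) s = exist _ E clE] =
    \bigcap_v [set s | D (s * v) <-> E v].
  apply/seteqP; split=> s /=.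
    by move=> /(congr1 sval)/= <- v _.
  by move=> DE; apply: clopen_type_inj; apply/seteqP; split=> v /= /DE; exact.
split; last first.
  apply: closed_bigI => v _; have [Ev|nEv] := pselect (E v).
    rewrite (_ : mkset _ = (fun s => s * v) @^-1` D).
      exact: (preimage_clopen clD (@continuous_mulgr v)).2.
    by apply/seteqP; split=> s /=; tauto.
  rewrite (_ : mkset _ = ~` ((fun s => s * v) @^-1` D)).
    exact/open_closedC/(preimage_clopen clD (@continuous_mulgr v)).1.
  by apply/seteqP; split=> s /=; tauto.
rewrite openE => s /= sDE.
have near_v (v : S) : nbhs (v, s) [set vs : S * S | D (vs.2 * vs.1) <-> E vs.1].
  have mulc : continuous (fun vs : S * S => vs.2 * vs.1).
    move=> vs; apply: (@continuous_comp (S * S)%type (S * S)%type S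
        (fun vs : S * S => (vs.2, vs.1)) (fun xy => xy.1 * xy.2));
      last exact: smul_continuous.
    by apply: cvg_pair; [exact: cvg_snd|exact: cvg_fst].
  have fstc : continuous (@fst S S) by move=> ?; exact: cvg_fst.
  have near_clopen (T : topologicalType) (f : S * S -> T) (A : set T) :
      clopen A -> continuous f ->
      nbhs (v, s) [set vs : S * S | A (f vs) <-> A (f (v, s))].
    move=> clA fc; have [oA cA] := preimage_clopen clA fc.
    have [Afv|nAfv] := pselect (A (f (v, s))).
      by apply: filterS (open_nbhs_nbhs (conj oA Afv)) => vs.
    by apply: filterS (open_nbhs_nbhs (conj (closed_openC cA) nAfv)) => vs.
  apply: filterS2 (near_clopen _ _ _ clD mulc) (near_clopen _ _ _ clE fstc).
  by move=> vs /= Dvs Evs; have /= := sDE v I; tauto.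
have := iffLR (compact_near_coveringP _) S_compact S (nbhs s)
  (fun s v => D (s * v) <-> E v) _ (fun v _ => near_v v).
rewrite /interior => /(_ (nbhs_filter s)); apply: filterS => s' DE v _.
exact: DE.
Qed.

(** If s and t act alike, then s^-1 s v and s^-1 t v lie in the same clopen sets,
    so they are equal. Multiplying by s on the left and taking v = s^-1 s shows
    s = (s s^-1) t (s^-1 s), hence s lies below t; the situation is symmetric. *)
Lemma clopen_wagner_preston_inj (code : clopen_type -> nat)
    (code_inj : injective code) :
  zero_dimensional S -> injective (wagner_preston code_inj clopen_actM).
Proof.
move=> zS; have eq_mulV s t v :
    wagner_preston code_inj clopen_actM s = wagner_preston code_inj clopen_actM t ->
    s * v = s * (sinv s * t * v).
  move=> st; suff -> : sinv s * t * v = sinv s * s * v by rewrite !mulgA mulgVg.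
  apply: contrapT => /eqP/zS[U [clU Ut Us]]; apply: Us.
  have := wagner_preston_eq (exist _ U clU : clopen_type) st.
  by move=> /(congr1 (fun D : clopen_type => sval D v)) /= ->.
have restr s t :
    wagner_preston code_inj clopen_actM s = wagner_preston code_inj clopen_actM t ->
    exists2 e, e * e = e & s = t * e.
  move=> st.
  (* s = (s s^-1) t (s^-1 s), and s s^-1 crosses t as t^-1 (s s^-1) t. *)
  exists (sinv t * (s * sinv s) * t * (sinv s * s)).
    apply: idem_mul; last exact: idem_mulVg.
    exact/idem_conj/idem_mulgV.
  rewrite mulgA -idem_mul_swap; last exact: idem_mulgV.
  by have := eq_mulV s t (sinv s * s) st; rewrite !mulgA mulgVg.
move=> s t st; have [e ee se] := restr s t st.
have [f ff tf] := restr t s (esym st).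
exact: natural_order_anti ee ff se tf.
Qed.

End clopen_action.

Lemma countable_clopen_embedding (S : topologicalInverseSemigroupType) :
  compact [set: S] -> countable (@clopen S) -> zero_dimensional S ->
  exists phi : S -> pperm,
    [/\ injective phi, {morph phi : s t / s * t} & continuous phi].
Proof.
move=> cS /countable_injP[e einj] zS.
have code_inj : injective (e \o sval : clopen_type S -> nat).
  move=> [D clD] [E clE] /= eDE; apply: clopen_type_inj.
  by apply: einj => //=; exact/mem_set.
exists (wagner_preston code_inj (@clopen_actM S)); split.
- exact: clopen_wagner_preston_inj.
- exact: wagner_preston_morph.
- by apply: wagner_preston_continuous => D E; exact: clopen_act_clopen.
Qed.

(** * From partial permutations to transformations *)

(** 0 is the added point, fixed by every totalization, and n + 1 stands for n. *)
Definition pperm_totalization (h : pperm) : transf :=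
  fun n => if n is m.+1 then
    if pselect (exists k, pgraph h (m, k)) is left hm then (projT1 (cid hm)).+1
    else 0%N else 0%N.

Lemma pperm_totalizationP h m k :
  pperm_totalization h m.+1 = k.+1 <-> pgraph h (m, k).
Proof.
rewrite /pperm_totalization; case: pselect => [hm|nhm].
  case: cid => k' hmk' /=; split=> [[<-]//|hmk].
  by rewrite (pperm_functional hmk hmk').
by split=> // hmk; case: nhm; exists k.
Qed.

Lemma pperm_totalization0 h m :
  pperm_totalization h m.+1 = 0%N <-> ~ pperm_dom h m.
Proof. by rewrite /pperm_totalization; case: pselect => [hm|nhm]; split. Qed.

Lemma pperm_totalization_inj : injective pperm_totalization.
Proof.
move=> g h gh; apply/pperm_eq/seteqP.
by split=> -[m k] /pperm_totalizationP H; apply/pperm_totalizationP; rewrite -H gh.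
Qed.

Lemma pperm_totalization_morph : {morph pperm_totalization : g h / g * h}.
Proof.
move=> g h; apply/funext => -[//|m].
have -> : (pperm_totalization g * pperm_totalization h) m.+1 =
    pperm_totalization h (pperm_totalization g m.+1) by [].
case gm : (pperm_totalization g m.+1) => [|k].
  apply/pperm_totalization0 => -[l [k gk _]].
  by move/pperm_totalization0: gm; apply; exists k.
move/pperm_totalizationP: gm => gmk.
case hk : (pperm_totalization h k.+1) => [|l].
  apply/pperm_totalization0 => -[l [k' /= gk' hk'l]].
  move/pperm_totalization0: hk; apply; exists l.
  by rewrite (pperm_functional gmk gk').
by move/pperm_totalizationP: hk => hkl; apply/pperm_totalizationP; exists k.
Qed.

Lemma pperm_totalization_continuous : continuous pperm_totalization.
Proof.
apply: continuous_transf => -[|n] [|m].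
- by rewrite (_ : mkset _ = setT); [exact: openT|apply/seteqP; split].
- by rewrite (_ : mkset _ = set0); [exact: open0|apply/seteqP; split].
- rewrite (_ : mkset _ = [set h | ~ pperm_dom h n]).
    by apply: pperm_subbase_open; right; left; exists n.
  by apply/seteqP; split=> h /= /pperm_totalization0.
- rewrite (_ : mkset _ = [set h | pgraph h (n, m)]).
    exact: (pperm_graph_clopen n m).1.
  by apply/seteqP; split=> h /= /pperm_totalizationP.
Qed.

(** * The equivalence *)

(** On a compact S, continuity of the inverse of an embedding is automatic. *)
Lemma compact_topological_embedding (S : topologicalInverseSemigroupType)
    (T : PreTopologicalSemigroup.type) (phi : S -> T) :
  compact [set: S] -> clopen_separated T -> injective phi ->
  {morph phi : s t / s * t} -> continuous phi -> topological_embedding phi.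
Proof.
move=> cS sT phi_inj phiM phic; split=> //.
have [f [g [fc gc fK gK fphi]]] := compact_embedding cS sT phic phi_inj.
by exists g => // y; rewrite -fphi gK.
Qed.

Theorem theorem2p4 (R : realType) (S : topologicalInverseSemigroupType)
    (S_compact : compact [set: S]) :
  [<-> homeomorphic_to_subspace S transf /\ homeomorphic_to_subspace S pperm;
       embeds_topologically S pperm;
       embeds_topologically S transf;
       metrizable R S /\ totally_disconnected [set: S]]
  /\ (homeomorphic_to_subspace S transf <-> homeomorphic_to_subspace S pperm).
Proof.
have sep_sub : clopen_separated S ->
    homeomorphic_to_subspace S transf /\ homeomorphic_to_subspace S pperm.
  move=> sS; have [f fc fi] := clopen_separated_inj_transf sS.
  have [g gc gi] := clopen_separated_inj_pperm sS.
  split; first exact: compact_homeomorphic_to_subspace clopen_separated_transf fc fi.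
  exact: compact_homeomorphic_to_subspace clopen_separated_pperm gc gi.
have transf_sep : homeomorphic_to_subspace S transf -> clopen_separated S.
  move/homeomorphic_to_subspace_clopen_separated; apply.
  exact: clopen_separated_transf.
have pperm_sep : homeomorphic_to_subspace S pperm -> clopen_separated S.
  move/homeomorphic_to_subspace_clopen_separated; apply.
  exact: clopen_separated_pperm.
split; last by split=> [/transf_sep|/pperm_sep] /sep_sub[].
tfae.
- move=> [/transf_sep sS _].
  have mS := @compact_clopen_separated_metrizable R S S_compact sS.
  have [phi [phi_inj phiM phic]] := countable_clopen_embedding S_compact
    (compact_metrizable_clopen_countable S_compact mS)
    (clopen_separated_zero_dimensional sS).
  exists phi; apply: compact_topological_embedding => //.
  exact: clopen_separated_pperm.
- move=> [phi [[phi_inj phiM] phic _]]; exists (pperm_totalization \o phi).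
  apply: compact_topological_embedding => //.
  + exact: clopen_separated_transf.
  + exact: inj_comp pperm_totalization_inj phi_inj.
  + by move=> s t /=; rewrite phiM pperm_totalization_morph.
  + move=> s; apply: (continuous_comp (phic s)).
    exact: pperm_totalization_continuous.
- move=> [phi [[phi_inj _] phic _]].
  have sS := clopen_separated_inj phic phi_inj clopen_separated_transf.
  split; first exact: compact_clopen_separated_metrizable.
  exact/zero_dimension_totally_disconnected/clopen_separated_zero_dimensional.
- move=> [mS tdS]; apply: sep_sub; apply: countable_clopen_separated.
    exact: compact_metrizable_clopen_countable mS.
  apply: compact_totally_disconnected_zero_dimensional => //.
  have [M [f [g [fc gc fK gK]]]] := mS.
  exact: hausdorff_inj fc (can_inj fK) (@metric_hausdorff _ M).
Qed.
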